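(* Let $H$ be the $\mathbb{K}$-algebra presented by the relations (Z1)–(Z11) of the context. Let $0\le i\le 6$, $0\le j\le 3$, and let $U,V$ be (possibly empty) words in the letters $a_0,a_1,a_2,a_3$. Then the word $LUQ_iP_jVR$ is a zero divisor in $H$ if and only if the Turing machine started in the full state $T(i,j,U,V)$ halts.
   Context: **Machine.** States $0,\dots,6$, tape colours $0,\dots,3$ (colour $0$ is blank). Instructions $(i,j)\to(D,q(i,j),p(i,j))$: in state $i$ on a cell of colour $j$, recolour the cell to $p(i,j)$, move the head one cell in direction $D$ ($L$ = left, $R$ = right), and change to state $q(i,j)$. The table is: $(0,0)\to(L,4,1)$, $(0,1)\to(L,1,3)$, $(0,2)\to(R,0,0)$, $(0,3)\to(R,0,1)$; $(1,0)\to(L,1,2)$, $(1,1)\to(L,1,3)$, $(1,2)\to(R,0,0)$, $(1,3)\to(L,1,3)$; $(2,0)\to(R,2,2)$, $(2,1)\to(R,2,1)$, $(2,2)\to(R,2,0)$, $(2,3)\to(L,4,1)$; $(3,0)\to(R,3,2)$, $(3,1)\to(R,3,1)$, $(3,2)\to(R,3,0)$, $(3,3)\to(L,4,0)$; $(4,0)\to(L,5,2)$, $(4,1)\to(L,4,1)$, $(4,2)\to(L,4,0)$, $(4,3)\to$ STOP; $(5,0)\to(L,5,2)$, $(5,1)\to(L,5,1)$, $(5,2)\to(L,6,2)$, $(5,3)\to(R,2,1)$; $(6,0)\to(R,0,3)$, $(6,1)\to(R,6,3)$, $(6,2)\to(R,6,2)$, $(6,3)\to(R,3,1)$. A pair $(i,j)\ne(4,3)$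 is a left (right) pair if its direction is $L$ ($R$). **Full states.** $T(i,j,U,V)$, with $U=a_{u_1}\cdots a_{u_k}$, $V=a_{v_1}\cdots a_{v_l}$, is the configuration in state $i$, current cell of colour $j$, cells to the left of the head coloured $u_1,\dots,u_k$ (left to right), cells to the right coloured $v_1,\dots,v_l$, and all other cells blank. Its next state $T(i',j',U',V')$, for $(i,j)\neq(4,3)$, is given by $i'=q(i,j)$ and: for a left pair, $V'=a_{p(i,j)}V$, and if $U=\tilde Ua_k$ then $j'=k$, $U'=\tilde U$, while if $U$ is empty then $j'=0$, $U'$ is empty; for a right pair, $U'=Ua_{p(i,j)}$, and if $V=a_k\tilde V$ then $j'=k$, $V'=\tilde V$, while if $V$ is empty then $j'=0$, $V'$ is empty. The machine halts when it reaches a full state with $(i,j)=(4,3)$. **Algebra $H$.** $H$ is the (unital) associative algebra over a field $\mathbb{K}$ with generators $\Psi=\{t,s,a_0,\dots,a_3,Q_0,\dots,Q_6,P_0,\dots,P_3,L,R\}$ and relations (indices $k,l$ range over $0,\dots,3$; write $q=q(i,j)$, $p=p(i,j)$): (Z1) $tLa_k=Lta_k$; (Z2) $ta_ka_l=a_kta_l$; (Z3) $sR=Rs$; (Z4) $sa_k=a_ks$; (Z5) $ta_kQ_iP_j=Q_{q}P_ka_{p}s$ for left pairs $(i,j)$; (Z6) $tLQ_iP_j=LQ_{q}P_0a_{p}s$ for left pairs $(i,j)$; (Z7) $ta_lQ_iP_ja_k=a_la_{p}Q_{q}P_ks$ for right pairs $(i,j)$; (Z8) $tLQ_iP_ja_k=La_{p}Q_{q}P_ks$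 for right pairs $(i,j)$; (Z9) $ta_lQ_iP_jR=a_la_{p}Q_{q}P_0Rs$ for right pairs $(i,j)$; (Z10) $tLQ_iP_jR=La_{p}Q_{q}P_0Rs$ for right pairs $(i,j)$; (Z11) $Q_4P_3=0$. **Zero divisor.** An element $w\in H$ is a zero divisor if there is a nonzero $X\in H$ with $Xw=0$ or a nonzero $Y\in H$ with $wY=0$. *)

(* Defs.v *)
From HB Require Import structures.
From mathcomp Require Import all_boot all_algebra.
From mathcomp Require Import boolp.
From mathcomp.multinomials Require Import monalg.

Set Implicit Arguments.
Unset Strict Implicit.
Unset Printing Implicit Defensive.

Import GRing.Theory.
Local Open Scope ring_scope.
Local Open Scope quotient_scope.

Notation state := 'I_7.
Notation color := 'I_4.

Variant direction := MoveL | MoveR.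

Notation st n := (@Ordinal 7 n isT) (only parsing).
Notation co n := (@Ordinal 4 n isT) (only parsing).
Local Notation goL q p := (Some (MoveL, st q, co p)) (only parsing).
Local Notation goR q p := (Some (MoveR, st q, co p)) (only parsing).

(* [instr i j = Some (D, q(i,j), p(i,j))]; STOP is [None].  The final branch is
   never reached, as [i < 7] and [j < 4]. *)
Definition instr (i : state) (j : color) : option (direction * state * color) :=
  match nat_of_ord i, nat_of_ord j with
  | 0, 0 => goL 4 1 | 0, 1 => goL 1 3 | 0, 2 => goR 0 0 | 0, 3 => goR 0 1
  | 1, 0 => goL 1 2 | 1, 1 => goL 1 3 | 1, 2 => goR 0 0 | 1, 3 => goL 1 3
  | 2, 0 => goR 2 2 | 2, 1 => goR 2 1 | 2, 2 => goR 2 0 | 2, 3 => goL 4 1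
  | 3, 0 => goR 3 2 | 3, 1 => goR 3 1 | 3, 2 => goR 3 0 | 3, 3 => goL 4 0
  | 4, 0 => goL 5 2 | 4, 1 => goL 4 1 | 4, 2 => goL 4 0 | 4, 3 => None
  | 5, 0 => goL 5 2 | 5, 1 => goL 5 1 | 5, 2 => goL 6 2 | 5, 3 => goR 2 1
  | 6, 0 => goR 0 3 | 6, 1 => goR 6 3 | 6, 2 => goR 6 2 | 6, 3 => goR 3 1
  | _, _ => None
  end%N.

(* Both tape words are read left to right: the left neighbour of the head is the
   last letter of [fs_left], its right neighbour the first letter of [fs_right]. *)
Record full_state := T {
  fs_state : state;
  fs_color : color;
  fs_left : seq color;
  fs_right : seq color }.

Definition fs_next (c : full_state) : option full_state :=
  let: T i j U V := c in
  match instr i j with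
  | None => None
  | Some (MoveL, q, p) =>
      Some (if U is u :: U0 then T q (last u U0) (belast u U0) (p :: V)
            else T q (co 0) [::] (p :: V))
  | Some (MoveR, q, p) =>
      Some (if V is v :: V0 then T q v (rcons U p) V0
            else T q (co 0) (rcons U p) [::])
  end.

Definition halts (c : full_state) : Prop :=
  exists (n : nat) (c' : full_state),
    iter n (obind fs_next) (Some c) = Some c' /\
    (fs_state c' = st 4 /\ fs_color c' = co 3).

Variant gen :=
  | gt | gs | ga of color | gQ of state | gP of color | gL | gR.

Definition gen_enc (g : gen) : (bool * bool) + (color + (state + color)) :=
  match g with
  | gt => inl (false, false) | gs => inl (false, true)
  | gL => inl (true, false) | gR => inl (true, true)
  | ga k => inr (inl k) | gQ i => inr (inr (inl i)) | gP j => inr (inr (inr j))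
  end.

Definition gen_dec (x : (bool * bool) + (color + (state + color))) : gen :=
  match x with
  | inl (false, false) => gt | inl (false, true) => gs
  | inl (true, false) => gL | inl (true, true) => gR
  | inr (inl k) => ga k | inr (inr (inl i)) => gQ i | inr (inr (inr j)) => gP j
  end.

Lemma gen_encK : cancel gen_enc gen_dec. Proof. by case. Qed.

HB.instance Definition _ := Finite.copy gen (can_type gen_encK).

Notation free_alg K := {malg K[{fmonom gen}]}.

Definition freegen (K : fieldType) (g : gen) : free_alg K := << fmu g >>.

Section Relators.
Variable K : fieldType.
Local Notation t := (freegen K gt).
Local Notation s := (freegen K gs).
Local Notation a k := (freegen K (ga k)).
Local Notation Q i := (freegen K (gQ i)).
Local Notation P j := (freegen K (gP j)).
Local Notation L := (freegen K gL).
Local Notation R := (freegen K gR).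

Inductive relator : free_alg K -> Prop :=
| Z1 k : relator (t * L * a k - L * t * a k)
| Z2 k l : relator (t * a k * a l - a k * t * a l)
| Z3 : relator (s * R - R * s)
| Z4 k : relator (s * a k - a k * s)
| Z5 i j q p k : instr i j = Some (MoveL, q, p) ->
    relator (t * a k * Q i * P j - Q q * P k * a p * s)
| Z6 i j q p : instr i j = Some (MoveL, q, p) ->
    relator (t * L * Q i * P j - L * Q q * P (co 0) * a p * s)
| Z7 i j q p k l : instr i j = Some (MoveR, q, p) ->
    relator (t * a l * Q i * P j * a k - a l * a p * Q q * P k * s)
| Z8 i j q p k : instr i j = Some (MoveR, q, p) ->
    relator (t * L * Q i * P j * a k - L * a p * Q q * P k * s)
| Z9 i j q p l : instr i j = Some (MoveR, q, p) ->
    relator (t * a l * Q i * P j * R - a l * a p * Q q * P (co 0) * R * s)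
| Z10 i j q p : instr i j = Some (MoveR, q, p) ->
    relator (t * L * Q i * P j * R - L * a p * Q q * P (co 0) * R * s)
| Z11 : relator (Q (st 4) * P (co 3)).

End Relators.

Section IdealGeneratedBy.
Variables (A : nzRingType) (S : A -> Prop).

Inductive ideal_gen : A -> Prop :=
| ideal_base x : S x -> ideal_gen x
| ideal_zero : ideal_gen 0
| ideal_add x y : ideal_gen x -> ideal_gen y -> ideal_gen (x + y)
| ideal_mull x y : ideal_gen y -> ideal_gen (x * y)
| ideal_mulr x y : ideal_gen x -> ideal_gen (x * y).

Lemma ideal_opp x : ideal_gen x -> ideal_gen (- x).
Proof. by rewrite -mulN1r; apply: ideal_mull. Qed.

End IdealGeneratedBy.

Section Quotient.
Variable K : fieldType.
Local Notation F := (free_alg K).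

Definition Hideal : pred F := fun x => asbool (ideal_gen (@relator K) x).

Lemma HidealP x : reflect (ideal_gen (@relator K) x) (x \in Hideal).
Proof. exact: asboolP. Qed.

Lemma Hideal_zmod_closed : zmod_closed Hideal.
Proof.
split=> [|x y /HidealP hx /HidealP hy]; apply/HidealP; first exact: ideal_zero.
by apply: ideal_add => //; apply: ideal_opp.
Qed.

HB.instance Definition _ := GRing.isZmodClosed.Build F Hideal Hideal_zmod_closed.

Lemma Hideal_mull x y : y \in Hideal -> x * y \in Hideal.
Proof. by move=> /HidealP h; apply/HidealP; apply: ideal_mull. Qed.

Lemma Hideal_mulr x y : x \in Hideal -> x * y \in Hideal.
Proof. by move=> /HidealP h; apply/HidealP; apply: ideal_mulr. Qed.

Lemma freegen_coef1 g : (freegen K g)@_mone = 0.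
Proof. by rewrite mcoeffU1 fm1_eq1. Qed.

Lemma coef1M (x y : F) : (x * y)@_mone = x@_mone * y@_mone.
Proof. exact: (rmorphM (@mcoeff _ K mone)). Qed.

Lemma coef1Mg x g : (x * freegen K g)@_mone = 0.
Proof. by rewrite coef1M freegen_coef1 mulr0. Qed.

Lemma coef1B x y g h : (x * freegen K g - y * freegen K h)@_mone = 0.
Proof. by rewrite mcoeffB !coef1Mg subr0. Qed.

Lemma Hideal_coef1 x : x \in Hideal -> x@_mone = 0.
Proof.
move=> /HidealP; elim=> {x} [x|||x y _|x y _].
- by case=> *; apply: coef1B || apply: coef1Mg.
- by rewrite mcoeff0.
- by move=> x y _ hx _ hy; rewrite mcoeffD hx hy addr0.
- by move=> hy; rewrite coef1M hy mulr0.
- by move=> hx; rewrite coef1M hx mul0r.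
Qed.

Definition H : Type := Quotient.quot (GRing.ZmodClosed.clone F Hideal _).

HB.instance Definition _ := Choice.on H.
HB.instance Definition _ := EqQuotient.on H.
HB.instance Definition _ := GRing.Zmodule.on H.
HB.instance Definition _ := ZmodQuotient.on H.

Definition Hone : H := lift_cst H 1.
Definition Hmul := lift_op2 H *%R.
Definition Hscale (c : K) := lift_op1 H ( *:%R c).

Canonical pi_Hone_morph := PiConst Hone.

Lemma pi_Hmul : {morph \pi_H : x y / x * y >-> Hmul x y}.
Proof.
move=> x y; unlock Hmul; apply/eqP; rewrite piE Quotient.equivE.
rewrite -[_ * _](addrNK (x * repr (\pi_H y))) -mulrBr -addrA -mulrBl.
by apply: rpredD; [apply: Hideal_mull|apply: Hideal_mulr];
  rewrite Quotient.idealrBE reprK.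
Qed.
Canonical pi_Hmul_morph := PiMorph2 pi_Hmul.

Lemma pi_Hscale c : {morph \pi_H : x / c *: x >-> Hscale c x}.
Proof.
move=> x; unlock Hscale; apply/eqP; rewrite piE Quotient.equivE.
rewrite -scalerBr -mul_malgC; apply: Hideal_mull.
by rewrite Quotient.idealrBE reprK.
Qed.
Canonical pi_Hscale_morph c := PiMorph1 (pi_Hscale c).

Lemma HmulA : associative Hmul.
Proof. by elim/quotW=> x; elim/quotW=> y; elim/quotW=> z; rewrite !piE mulrA. Qed.
Lemma Hmul1 : left_id Hone Hmul.
Proof. by elim/quotW=> x; rewrite !piE mul1r. Qed.
Lemma Hmulr1 : right_id Hone Hmul.
Proof. by elim/quotW=> x; rewrite !piE mulr1. Qed.
Lemma HmulDl : left_distributive Hmul +%R.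
Proof. by elim/quotW=> x; elim/quotW=> y; elim/quotW=> z; rewrite !piE mulrDl. Qed.
Lemma HmulDr : right_distributive Hmul +%R.
Proof. by elim/quotW=> x; elim/quotW=> y; elim/quotW=> z; rewrite !piE mulrDr. Qed.
Lemma Hone_neq0 : Hone != 0.
Proof.
rewrite piE Quotient.equivE subr0; apply/negP => /Hideal_coef1.
by rewrite mcoeff1 eqxx; apply/eqP/oner_neq0.
Qed.

HB.instance Definition _ := GRing.Zmodule_isNzRing.Build H
  HmulA Hmul1 Hmulr1 HmulDl HmulDr Hone_neq0.

Lemma pi_Hone : \pi_H 1 = 1. Proof. by rewrite piE. Qed.

HB.instance Definition _ :=
  @isNzRingQuotient.Build F (Quotient.equiv (GRing.ZmodClosed.clone F Hideal _)) 0 -%R +%R 1 *%R H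
    pi_Hone pi_Hmul.

Lemma HscaleA a b v : Hscale a (Hscale b v) = Hscale (a * b) v.
Proof. by elim/quotW: v => x; rewrite !piE scalerA. Qed.
Lemma Hscale1 : left_id 1 Hscale.
Proof. by elim/quotW=> x; rewrite !piE scale1r. Qed.
Lemma HscaleDr : right_distributive Hscale +%R.
Proof. by move=> c; elim/quotW=> x; elim/quotW=> y; rewrite !piE scalerDr. Qed.
Lemma HscaleDl v : {morph Hscale^~ v : a b / a + b}.
Proof. by elim/quotW: v => x a b; rewrite !piE scalerDl. Qed.

HB.instance Definition _ := GRing.Zmodule_isLmodule.Build K H
  HscaleA Hscale1 HscaleDr HscaleDl.

Lemma HscaleAl (c : K) (u v : H) : c *: (u * v) = (c *: u) * v.
Proof.
rewrite -[LHS]/(Hscale c (Hmul u v)) -[RHS]/(Hmul (Hscale c u) v).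
by elim/quotW: u => x; elim/quotW: v => y; rewrite !piE scalerAl.
Qed.

HB.instance Definition _ := GRing.Lmodule_isLalgebra.Build K H HscaleAl.

Lemma malgC_comm (c : K) (x : F) : malgC c * x = x * malgC c.
Proof.
rewrite !malgM_def fgmulUg fgmulgU; apply: eq_bigr => m _.
by rewrite mul1m mulm1 mulrC.
Qed.

Lemma free_scalerAr (c : K) (x y : F) : c *: (x * y) = x * (c *: y).
Proof.
by rewrite -(mul_malgC c (x * y)) -(mul_malgC c y) !mulrA malgC_comm.
Qed.

Lemma HscaleAr (c : K) (u v : H) : c *: (u * v) = u * (c *: v).
Proof.
rewrite -[LHS]/(Hscale c (Hmul u v)) -[RHS]/(Hmul u (Hscale c v)).
by elim/quotW: u => x; elim/quotW: v => y; rewrite !piE free_scalerAr.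
Qed.

HB.instance Definition _ := GRing.Lalgebra_isAlgebra.Build K H HscaleAr.

Definition Hpi (x : F) : H := \pi_H x.

Lemma Hpi_zmod_morphism : zmod_morphism Hpi.
Proof. by move=> x y; rewrite /Hpi !piE. Qed.
Lemma Hpi_monoid_morphism : monoid_morphism Hpi.
Proof. by split=> [|x y]; [exact: pi_Hone|exact: pi_Hmul]. Qed.
Lemma Hpi_scalable : scalable Hpi.
Proof. by move=> c x; exact: pi_Hscale. Qed.

HB.instance Definition _ := GRing.isZmodMorphism.Build F H Hpi Hpi_zmod_morphism.
HB.instance Definition _ :=
  GRing.isMonoidMorphism.Build F H Hpi Hpi_monoid_morphism.
HB.instance Definition _ := GRing.isScalable.Build K F H *:%R Hpi Hpi_scalable.

Lemma Hpi_surj (u : H) : exists x, u = Hpi x.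
Proof. by exists (repr u); rewrite /Hpi reprK. Qed.

Lemma Hpi_eq0 (x : F) : Hpi x = 0 <-> ideal_gen (@relator K) x.
Proof.
rewrite /Hpi; split=> [/eqP|/HidealP h]; last apply/eqP.
  by rewrite piE Quotient.equivE subr0 => /HidealP.
by rewrite piE Quotient.equivE subr0.
Qed.

Definition Hgen (g : gen) : H := Hpi (freegen K g).

End Quotient.

Definition zero_divisor (A : nzRingType) (w : A) : Prop :=
  (exists2 X : A, X != 0 & X * w = 0) \/ (exists2 Y : A, Y != 0 & w * Y = 0).

(* Main.v *)
(* Read from left to right, (Z1)-(Z11) is a rewriting system whose left-hand
   sides do not overlap.  Hence computing normal forms from right to left is an
   action of the generators on words ([lact]), and the normal words are a basis
   of [H].  Write W_n for the word of the n-th configuration: then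
   t^n W = W_n s^n.  If the machine halts, some W_n contains Q_4 P_3, so
   t^n W = 0 while t^n is normal, hence nonzero.  Otherwise W Y is normal for
   every normal word Y, and for a normal X t^n with X not ending in t, the normal
   form of X t^n W is X W_n s^n; both maps are injective on normal words, so W
   is not a zero divisor. *)
Require Import Defs.
From mathcomp Require Import all_boot all_algebra.
From mathcomp Require Import boolp finmap.
From mathcomp.multinomials Require Import monalg.

Set Implicit Arguments.
Unset Strict Implicit.
Unset Printing Implicit Defensive.

Import GRing.Theory.
Local Open Scope ring_scope.

(** * Left action of the generators on words, and normal words; [None] stands for zero *)

Fixpoint lact_s (w : seq gen) : seq gen :=
  match w with
  | ga k :: v => ga k :: lact_s v
  | gR :: v => gR :: lact_s v
  | _ => gs :: w
  end.

Definition lact_Q (q : state) (w : seq gen) : option (seq gen) :=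
  if (q == st 4) && (ohead w == Some (gP (co 3))) then None
  else Some (gQ q :: w).

(* The result of [t x Q_i P_j v], for [x] a letter [a_k] or [L]. *)
Definition move (x : gen) (i : state) (j : color) (v : seq gen) :
    option (seq gen) :=
  match instr i j, v with
  | Some (MoveL, q, p), _ =>
      if x is ga k then lact_Q q (gP k :: ga p :: lact_s v)
      else omap (cons x) (lact_Q q (gP (co 0) :: ga p :: lact_s v))
  | Some (MoveR, q, p), ga k :: v' =>
      omap (cat [:: x; ga p]) (lact_Q q (gP k :: lact_s v'))
  | Some (MoveR, q, p), gR :: v' =>
      omap (cat [:: x; ga p]) (lact_Q q (gP (co 0) :: gR :: lact_s v'))
  | _, _ => Some (gt :: x :: gQ i :: gP j :: v)
  end.

Definition tape_gen (x : gen) : bool :=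
  match x with gL | ga _ => true | _ => false end.

(** By [Z1] and [Z2], [t] passes tape letters up to the last one before the head, where [move]
    applies a pair relation. In the remaining branches no left-hand side matches. *)
Fixpoint lact_t (w : seq gen) : option (seq gen) :=
  if w is x :: w' then
    if tape_gen x then
      match w' with
      | ga _ :: _ => omap (cons x) (lact_t w')
      | gQ i :: gP j :: v => move x i j v
      | _ => Some (gt :: w)
      end
    else Some (gt :: w)
  else Some (gt :: w).

Definition lact (g : gen) (w : seq gen) : option (seq gen) :=
  match g with
  | gt => lact_t w
  | gs => Some (lact_s w)
  | gQ q => lact_Q q w
  | _ => Some (g :: w)
  end.

Definition lact_seq (u : seq gen) (o : option (seq gen)) : option (seq gen) :=
  foldr (fun g => obind (lact g)) o u.

Definition nf (u : seq gen) : option (seq gen) := lact_seq u (Some [::]).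

Lemma lact_seq_cat u v o : lact_seq (u ++ v) o = lact_seq u (lact_seq v o).
Proof. exact: foldr_cat. Qed.

Lemma lact_seq_None u : lact_seq u None = None.
Proof. by elim: u => //= g u ->. Qed.

Lemma nf_cat u v : nf (u ++ v) = lact_seq u (nf v).
Proof. exact: lact_seq_cat. Qed.

(** Irreducibility: a letter is merely prepended exactly when no left-hand side of a relation starts
    at it. *)
Fixpoint normal (w : seq gen) : bool :=
  if w is g :: v then (lact g v == Some (g :: v)) && normal v else true.

Lemma nf_normal w : normal w -> nf w = Some w.
Proof. by elim: w => //= g w IHw /andP[/eqP gw /IHw ->]. Qed.

Lemma normal_lact_s w : normal w -> normal (lact_s w).
Proof.
elim: w => [|g w IHw] //= /andP[gw nw].
by case: g gw => [||k|q|k||] gw /=; rewrite ?eqxx ?gw ?nw ?IHw.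
Qed.

Lemma normal_lact_Q q w v : normal w -> lact_Q q w = Some v -> normal v.
Proof.
move=> nw; rewrite /lact_Q; case: ifP => // qw [<-] /=.
by rewrite nw andbT /lact_Q qw.
Qed.

Lemma normal_tape x w : tape_gen x -> normal w -> normal (x :: w).
Proof. by case: x => //= [k|] _ ->; rewrite ?eqxx. Qed.

(** When [t] is merely prepended, normality of [v] follows from the equation [lact_t w = Some v]
    itself, so only rewritten results are analysed here; [normal_lact] joins the two cases. *)
Lemma normal_lact_t w v :
  normal w -> lact_t w = Some v -> v = gt :: w \/ normal v.
Proof.
have step x p q u u' : tape_gen x -> normal u ->
    omap (cat [:: x; ga p]) (lact_Q q u) = Some u' -> normal u'.
  move=> tx nu; case E: lact_Q => [u''|] //= [<-].
  by apply/normal_tape/normal_tape => //; apply: normal_lact_Q E.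
elim: w v => [|x w IHw] v; first by move=> _ [<-]; left.
rewrite /=; case: ifP => [tx|_]; last by move=> _ [<-]; left.
case: w IHw => [|g w] IHw; first by move=> _ [<-]; left.
case: g IHw => [||k|i|k||] IHw /andP[_ nw]; try by case=> <-; left.
  case E: (lact_t _) => [u|] //= [<-]; right; apply: normal_tape => //.
  case: (IHw u nw E) => // eu; move: nw; rewrite eu => nw.
  by apply/andP; split=> //; rewrite /lact -eu E.
case: w IHw nw => [|g w] IHw nw; first by case=> <-; left.
case: g IHw nw => [||k|i'|j||] IHw nw; try by case=> <-; left.
have {IHw} nw: normal w by case/and3P: nw.
rewrite /move; case: (instr i j) => [[[[|] q] p]|]; last by case=> <-; left.
- have ns k : normal (gP k :: ga p :: lact_s w).
    by rewrite /= !eqxx normal_lact_s.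
  case: x tx => // [k|] _; first by move=> E; right; apply: normal_lact_Q E.
  case E: lact_Q => [u|] //= [<-]; right.
  by apply: normal_tape => //; apply: normal_lact_Q E.
- case: w nw => [|g w] nw; first by case=> <-; left.
  case: g nw => [||k|i'|k||] nw; try by case=> <-; left.
    move/step=> nv; right; apply: nv => //=.
    by rewrite eqxx normal_lact_s //; case/andP: nw.
  move/step=> nv; right; apply: nv => //=.
  by rewrite !eqxx normal_lact_s //; case/andP: nw.
Qed.

Lemma normal_lact g w v : normal w -> lact g w = Some v -> normal v.
Proof.
move=> nw; have ng h u : normal u -> lact h u = Some (h :: u) -> normal (h :: u).
  by move=> nu E; rewrite /= E eqxx.
case: g => [||k|q|k||]; try by case=> <-; apply: ng.
- by move=> E; case: (normal_lact_t nw E) => // ev; move: E; rewrite ev; apply: ng.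
- by case=> <-; apply: normal_lact_s.
- exact: normal_lact_Q.
Qed.

Lemma nf_is_normal w v : nf w = Some v -> normal v.
Proof.
elim: w v => [|g w IHw] v /=; first by case=> <-.
by rewrite -/(nf w); case: (nf w) IHw => //= u IHw; apply: normal_lact; exact: IHw.
Qed.

(** * Normality under appending and removing suffixes *)

Lemma omap_cons_t x o w : omap (cons x) o = Some (gt :: w) -> ~~ tape_gen x.
Proof. by case: o => //= u [->]. Qed.

(** In a left-hand side, [L] occurs only right after an initial [t]. Hence appending a word that
    starts with [L] creates a new match only if the letter just before it is [t]. *)
Lemma lact_cat_L g w v : lact g w = Some (g :: w) -> ~~ ((g == gt) && nilp w) ->
  lact g (w ++ gL :: v) = Some (g :: w ++ gL :: v).
Proof.
case: g => [||k|q|k||] //=.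
- case: w => [|x w] //=; case: ifP => // tx.
  case: w => [|g w] //; case: g => // [k|i].
    by move/omap_cons_t ; rewrite tx.
  case: w => [|g w] //=; case: g => //= j.
  have ne o y : omap (cat [:: x; y]) o <> Some [:: gt, x, gQ i, gP j & w].
    by case: o => //= u [] ex; rewrite ex in tx.
  rewrite /move /lact_Q; case: (instr i j) => [[[[|] q] p]|] //.
    by case: x tx {ne} => // [k|] _; case: ifP.
  by case: w ne => [|g w] ne //=; case: g ne => // [k|] ne E _; case: (ne _ _ E).
- by case: w => [|g w] //=; case: g.
- by rewrite /lact_Q; case: w => [|g w] //=; case: ifP => //; rewrite andbF.
Qed.

(** A left-hand side at the start of [g :: w] is also at the start of [g :: w ++ v]. *)
Lemma lact_prefix g w v :
  lact g (w ++ v) = Some (g :: w ++ v) -> lact g w = Some (g :: w).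
Proof.
case: g => [||k|q|k||] //=.
- case: w => [|x w] //=; case: ifP => // tx.
  case: w => [|g w] //; case: g => // [k|i].
    by move/omap_cons_t ; rewrite tx.
  case: w => [|g w] //; case: g => // j.
  rewrite [(_ :: _) ++ v]/=.
  have ne o y : omap (cat [:: x; y]) o <> Some [:: gt, x, gQ i, gP j & w ++ v].
    by case: o => //= u [] ex; rewrite ex in tx.
  rewrite /move /lact_Q; case: (instr i j) => [[[[|] q] p]|] //.
    by case: x tx {ne} => // [k|] _; case: ifP.
  by case: w ne => [|g w] ne //=; case: g ne => // [k|] ne E; case: (ne _ _ E).
- by case: w => [|g w] //=; case: g.
- rewrite /lact_Q; case: w => [|g w] /=; last by case: ifP.
  by rewrite (_ : (None == _) = false) // andbF.
Qed.

Lemma normal_prefix u v : normal (u ++ v) -> normal u.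
Proof.
elim: u => //= g u IHu /andP[/eqP gu /IHu ->]; rewrite andbT.
by rewrite (lact_prefix gu).
Qed.

Lemma lact_seq_cat_L u v : normal u -> last gs u != gt ->
  lact_seq u (Some (gL :: v)) = Some (u ++ gL :: v).
Proof.
elim: u => //= g u IHu /andP[/eqP gu nu] lgu.
rewrite IHu //=; last by case: (u) lgu.
by rewrite lact_cat_L // /nilp; case: (u) lgu => [|h v'] /=; rewrite ?andbT ?andbF.
Qed.

(** * Configurations as words; one [t] performs one machine step *)

Definition stopped (c : full_state) : bool :=
  (fs_state c == st 4) && (fs_color c == co 3).

Definition conf_word (c : full_state) : seq gen :=
  gL :: map ga (fs_left c) ++ gQ (fs_state c) :: gP (fs_color c) ::
    map ga (fs_right c) ++ [:: gR].
Arguments conf_word : simpl never.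

Lemma instr_isSome (i : state) (j : color) :
  isSome (instr i j) = ~~ ((i == st 4) && (j == co 3)).
Proof.
by case: i j => [[|[|[|[|[|[|[|i]]]]]]] ?] [[|[|[|[|j]]]] ?].
Qed.

Lemma fs_next_isSome c : isSome (fs_next c) = ~~ stopped c.
Proof.
case: c => i j U V; rewrite /stopped /= -instr_isSome.
by case: (instr i j) => [[[[|] q] p]|]; case: U V => [|u U] [|v V].
Qed.

Lemma lact_s_nseq n : lact_s (nseq n gs) = nseq n.+1 gs.
Proof. by case: n. Qed.

Lemma lact_s_right V n :
  lact_s (map ga V ++ gR :: nseq n gs) = map ga V ++ gR :: nseq n.+1 gs.
Proof. by elim: V => /= [|v V ->] //; rewrite lact_s_nseq. Qed.

Lemma lact_t_cons x k w : tape_gen x ->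
  lact_t (x :: ga k :: w) = omap (cons x) (lact_t (ga k :: w)).
Proof. by rewrite /= => ->. Qed.

Lemma lact_t_left x U k w : tape_gen x ->
  lact_t (x :: map ga (rcons U k) ++ w)
  = omap (cat (x :: map ga U)) (lact_t (ga k :: w)).
Proof.
elim: U x => [|u U IHU] x tx.
  by rewrite [rcons _ _]/= [_ ++ w]/= lact_t_cons //; case: (lact_t _).
rewrite rcons_cons map_cons cat_cons lact_t_cons // IHU //.
by case: (lact_t _).
Qed.

Lemma lact_QP q k w :
  lact_Q q (gP k :: w)
  = if (q == st 4) && (k == co 3) then None else Some (gQ q :: gP k :: w).
Proof.
by rewrite /lact_Q (_ : (ohead _ == _) = (k == co 3)).
Qed.

Lemma conf_word_cat i j U V w :
  conf_word (T i j U V) ++ w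
  = gL :: map ga U ++ gQ i :: gP j :: map ga V ++ gR :: w.
Proof. by rewrite /conf_word /= -catA /= -catA. Qed.

(** [t] runs to the left neighbour of the head, performs the instruction there and leaves an [s],
    which runs right past [R] and joins the others. *)
Lemma lact_t_conf c c' n : fs_next c = Some c' ->
  lact_t (conf_word c ++ nseq n gs)
  = if stopped c' then None else Some (conf_word c' ++ nseq n.+1 gs).
Proof.
case: c c' => i j U V [i' j' U2 V2]; rewrite !conf_word_cat /stopped /fs_next.
(* The left neighbour is [L] if [U] is empty ([Z6], [Z8], [Z10]) and a colour otherwise ([Z5], [Z7],
   [Z9]). *)
case: (lastP U) => [|U' u].
  rewrite [map ga [::]]/= cat0s /= /move.
  case: (instr i j) => [[[[|] q] p]|] //.
    by case=> <- <- <- <-; rewrite lact_s_right lact_QP /=; case: ifP.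
  by case: V => [|v V] [<- <- <- <-]; rewrite /= ?lact_s_right
    ?lact_s_nseq lact_QP /=; case: ifP.
rewrite lact_t_left // [lact_t _]/= /move.
case: (instr i j) => [[[[|] q] p]|] //.
  (* [lastP] writes the left tape as [rcons U' u], while [fs_next] splits it by [last] and [belast];
     the two agree. *)
  move=> E; have {E} [<- <- <- <-]: T q u U' (p :: V) = T i' j' U2 V2.
    by case: E => <-; case: (U') => //= u0 U0; rewrite last_rcons belast_rcons.
  by rewrite lact_s_right lact_QP /=; case: ifP.
by case: V => [|v V] [<- <- <- <-]; rewrite /= ?lact_s_right
  ?lact_s_nseq lact_QP !map_rcons -!cats1 -!catA /=; case: ifP.
Qed.

Definition run (n : nat) (c : full_state) : option full_state :=
  iter n (obind fs_next) (Some c).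

Lemma lact_seq_tape U w :
  lact_seq (map ga U) (Some w) = Some (map ga U ++ w).
Proof. by elim: U => //= u U ->. Qed.

Lemma lact_seq_conf c w :
  lact_seq (conf_word c) (Some w)
  = if stopped c then None else Some (conf_word c ++ w).
Proof.
rewrite /conf_word /= lact_seq_cat /= lact_seq_cat /= lact_seq_tape /= lact_QP.
rewrite -/(stopped c); case: ifP => _; first by rewrite lact_seq_None.
by rewrite lact_seq_tape /= -!catA /= -!catA.
Qed.

Lemma nf_run c c' n : run n c = Some c' ->
  nf (nseq n gt ++ conf_word c)
  = if stopped c' then None else Some (conf_word c' ++ nseq n gs).
Proof.
elim: n c' => [|n IHn] c'; first by case=> <-; rewrite /nf lact_seq_conf.
rewrite /run iterS -/(run n c); case: (run n c) IHn => //= c'' /(_ c'' erefl) IHn E.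
(* A configuration with a successor is not stopped, so the normal form reached so far is not
   [None]. *)
have := fs_next_isSome c''; rewrite E /= => /esym/negPf c''N.
by rewrite -/(nf _) IHn c''N; apply: lact_t_conf E.
Qed.

(** A run can break off only after a stopped configuration, and none occurs. *)
Lemma run_of_not_halts c n : ~ halts c -> exists2 c', run n c = Some c' & ~~ stopped c'.
Proof.
move=> nh; have ns m c' : run m c = Some c' -> ~~ stopped c'.
  by move=> E; apply/negP => /andP[/eqP si /eqP sj]; apply: nh; exists m, c'.
elim: n => [|n [c' E c'N]]; first by exists c => //; apply: (ns 0).
have := c'N; rewrite -fs_next_isSome; case E': (fs_next c') => [d|] // _.
have Ed: run n.+1 c = Some d by rewrite /run iterS -/(run n c) E.
by exists d => //; apply: ns Ed.
Qed.

(** * Normal words times the word of a non-halting configuration *)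

Lemma last_t_split u : exists v n, u = v ++ nseq n gt /\ last gs v != gt.
Proof.
(* On the empty word [last] returns its default [gs], which differs from [gt]. *)
elim/last_ind: u => [|u g [v [n [-> lv]]]]; first by exists [::], 0%N.
have [->|gN] := eqVneq g gt.
  by exists v, n.+1; split=> //; rewrite rcons_cat -cats1 -addn1 nseqD.
by exists (rcons (v ++ nseq n gt) g), 0%N; rewrite cats0 last_rcons.
Qed.

(** The trailing power of [t] drives the machine [n] steps. The rest [v] does not end in [t], so it
    does not react with the leading [L] of the configuration word. *)
Lemma nf_normal_conf c u : ~ halts c -> normal u ->
  exists v n c', [/\ u = v ++ nseq n gt, run n c = Some c' &
    nf (u ++ conf_word c) = Some (v ++ conf_word c' ++ nseq n gs)].
Proof.
move=> nh; have [v [n [-> lv]]] := last_t_split u => nu.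
have [c' E c'N] := run_of_not_halts n nh.
exists v, n, c'; split=> //.
rewrite -catA nf_cat (nf_run E) (negPf c'N) lact_seq_cat_L //.
exact: normal_prefix nu.
Qed.

(** The exponent [n] is read off as the number of letters [s] after the last [R]; it determines the
    configuration, and cancelling the common suffix leaves [v]. *)
Lemma nf_normal_conf_inj c u1 u2 : ~ halts c -> normal u1 -> normal u2 ->
  nf (u1 ++ conf_word c) = nf (u2 ++ conf_word c) -> u1 = u2.
Proof.
move=> nh /(nf_normal_conf nh)[v1 [n1 [c1 [-> E1 ->]]]].
move=> /(nf_normal_conf nh)[v2 [n2 [c2 [-> E2 ->]]]] [].
have split_s v d n : v ++ conf_word d ++ nseq n gs
    = (v ++ gL :: map ga (fs_left d) ++ gQ (fs_state d) :: gP (fs_color d) ::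
        map ga (fs_right d)) ++ gR :: nseq n gs.
  by rewrite /conf_word -!catA /= -!catA /= -!catA.
(* The reversed word starts with [n] letters [s] followed by [R], so the first letter other than [s]
   has index [n]. *)
have count_s w n : find (predC1 gs) (rev (w ++ gR :: nseq n gs)) = n.
  rewrite -cat_rcons rev_cat rev_rcons rev_nseq.
  by elim: n => //= n ->.
move=> E; have en: n1 = n2.
  by have := congr1 (find (predC1 gs) \o rev) E; rewrite /= !split_s !count_s.
move: E E1; rewrite en => E; rewrite E2 => -[ec].
(* The suffixes now coincide, so the prefixes have equal length, as [eqseq_cat] requires. *)
have sz: size v1 = size v2.
  by have /eqP := congr1 size E; rewrite ec !size_cat eqn_add2r => /eqP.
by move/eqP: E; rewrite ec eqseq_cat // => /andP[/eqP ->].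
Qed.

(* The relations (Z1)-(Z11) as pairs of words, [None] standing for [0]. *)
Inductive word_rel : seq gen -> option (seq gen) -> Prop :=
| W1 k : word_rel [:: gt; gL; ga k] (Some [:: gL; gt; ga k])
| W2 k l : word_rel [:: gt; ga k; ga l] (Some [:: ga k; gt; ga l])
| W3 : word_rel [:: gs; gR] (Some [:: gR; gs])
| W4 k : word_rel [:: gs; ga k] (Some [:: ga k; gs])
| W5 i j q p k : instr i j = Some (MoveL, q, p) ->
    word_rel [:: gt; ga k; gQ i; gP j] (Some [:: gQ q; gP k; ga p; gs])
| W6 i j q p : instr i j = Some (MoveL, q, p) ->
    word_rel [:: gt; gL; gQ i; gP j] (Some [:: gL; gQ q; gP (co 0); ga p; gs])
| W7 i j q p k l : instr i j = Some (MoveR, q, p) ->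
    word_rel [:: gt; ga l; gQ i; gP j; ga k]
      (Some [:: ga l; ga p; gQ q; gP k; gs])
| W8 i j q p k : instr i j = Some (MoveR, q, p) ->
    word_rel [:: gt; gL; gQ i; gP j; ga k]
      (Some [:: gL; ga p; gQ q; gP k; gs])
| W9 i j q p l : instr i j = Some (MoveR, q, p) ->
    word_rel [:: gt; ga l; gQ i; gP j; gR]
      (Some [:: ga l; ga p; gQ q; gP (co 0); gR; gs])
| W10 i j q p : instr i j = Some (MoveR, q, p) ->
    word_rel [:: gt; gL; gQ i; gP j; gR]
      (Some [:: gL; ga p; gQ q; gP (co 0); gR; gs])
| W11 : word_rel [:: gQ (st 4); gP (co 3)] None.

(** * Invariance of normal forms under the relations *)

(** The action is built from the relations, so both sides compute to the same result on every word
    [w]. *)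
Lemma lact_seq_rel l o w : word_rel l o ->
  lact_seq l (Some w) = obind (fun m => lact_seq m (Some w)) o.
Proof.
(* A pair with an instruction is not the stop pair, so [Z11] does not interfere with its
   [Q_i P_j]. *)
have Q43 i j D q p v : instr i j = Some (D, q, p) ->
    lact_Q i (gP j :: v) = Some (gQ i :: gP j :: v).
  by move=> E; have := instr_isSome i j; rewrite lact_QP E; case: andb.
case=> {l o} // [i j q p k|i j q p|i j q p k l|i j q p k|i j q p l|i j q p] E;
  rewrite /= (Q43 _ _ _ _ _ _ E) /= /move E ?lact_QP //=; by case: andb.
Qed.

Lemma nf_rel l o u v : word_rel l o ->
  nf (u ++ l ++ v) = obind (fun m => nf (u ++ m ++ v)) o.
Proof.
by case: o => [m|] r; rewrite /= !nf_cat; case: (nf v) => [w|];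
  rewrite ?(lact_seq_rel _ r) ?lact_seq_None.
Qed.

(** * Linear extension from a basis, and linear maps vanishing on an ideal *)

Section LinearExtension.
Variables (K : fieldType) (I : choiceType) (V : lmodType K) (h : I -> V).

Definition linext (x : {malg K[I]}) : V := \sum_(m <- msupp x) x@_m *: h m.

(** Enlarging the index set adds only zero coefficients; this lets sums over different supports be
    combined. *)
Lemma linextEw (d : {fset I}) x : (msupp x `<=` d)%fset ->
  linext x = \sum_(m <- d) x@_m *: h m.
Proof.
move=> le; rewrite /linext (big_fset_incl _ le) //= => m _ /mcoeff_outdom ->.
by rewrite scale0r.
Qed.

Lemma linextD x y : linext (x + y) = linext x + linext y.
Proof.
rewrite (linextEw (msuppD_le x y)) (linextEw (fsubsetUl (msupp x) (msupp y))).
rewrite (linextEw (fsubsetUr (msupp x) (msupp y))) -big_split /=.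
by apply: eq_bigr => m _; rewrite mcoeffD scalerDl.
Qed.

Lemma linext0 : linext 0 = 0.
Proof. by rewrite /linext msupp0 big_seq_fset0. Qed.

Lemma linextZ c x : linext (c *: x) = c *: linext x.
Proof.
rewrite (linextEw (msuppZ_le c x)) scaler_sumr.
by apply: eq_bigr => m _; rewrite mcoeffZ scalerA.
Qed.

Lemma linextB x y : linext (x - y) = linext x - linext y.
Proof. by rewrite linextD -(scaleN1r y) linextZ scaleN1r. Qed.

Lemma linextU m : linext << m >> = h m.
Proof. by rewrite /linext msuppU oner_eq0 big_seq_fset1 mcoeffUU scale1r. Qed.

Lemma malg_ind (P : {malg K[I]} -> Prop) :
  P 0 -> (forall x y, P x -> P y -> P (x + y)) ->
  (forall c m, P (c *: << m >>)) -> forall x, P x.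
Proof.
move=> P0 PD PZ x; rewrite (monalgE x); elim/big_ind: _ => // m _.
rewrite (_ : << _ *g m >> = x@_m *: << m >>) //.
by apply/malgP => k; rewrite mcoeffZ !mcoeffU mulr_natr.
Qed.

End LinearExtension.

(** By linearity in both outer factors, it suffices to test [f] on generators of the ideal placed
    between spanning elements [b i] and [b j]. *)
Lemma ideal_gen_ker (K : fieldType) (A : lalgType K) (V : lmodType K)
    (f : A -> V) (I : Type) (b : I -> A) (S : A -> Prop) :
  f 0 = 0 -> (forall x y, f (x + y) = f x + f y) ->
  (forall c x, f (c *: x) = c *: f x) ->
  (forall c (x y : A), c *: (x * y) = x * (c *: y)) ->
  (forall P : A -> Prop, P 0 -> (forall x y, P x -> P y -> P (x + y)) ->
     (forall c i, P (c *: b i)) -> forall x, P x) ->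
  (forall r i j, S r -> f (b i * r * b j) = 0) ->
  forall x, ideal_gen S x -> f x = 0.
Proof.
move=> f0 fD fZ sAr ind fS.
have bilin r : S r -> forall y z, f (y * r * z) = 0.
  move=> Sr; elim/ind => [z|y y' IHy IHy' z|c i].
  - by rewrite !mul0r f0.
  - by rewrite !mulrDl fD IHy IHy' addr0.
  elim/ind => [|z z' IHz IHz'|d j].
  - by rewrite mulr0 f0.
  - by rewrite mulrDr fD IHz IHz' addr0.
  by rewrite -sAr -!scalerAl !fZ fS // !scaler0.
(* The outer factors are carried along so that the induction survives multiplication on either
   side. *)
move=> x Ix; suff: forall u v, f (u * x * v) = 0.
  by move/(_ 1 1); rewrite mul1r mulr1.
elim: Ix => {x} [x Sx||x y _ IHx _ IHy|x y _ IHy|x y _ IHx] u v.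
- exact: bilin.
- by rewrite mulr0 mul0r f0.
- by rewrite mulrDr mulrDl fD IHx IHy addr0.
- by rewrite mulrA IHy.
- by rewrite mulrA -mulrA IHx.
Qed.

(** * Values of words in a ring where the relations hold *)

Section Evaluation.
Variables (A : nzRingType) (e : gen -> A).

Definition eval (w : seq gen) : A := \prod_(g <- w) e g.
Definition oeval (o : option (seq gen)) : A := oapp eval 0 o.

Lemma eval_nil : eval [::] = 1.
Proof. exact: big_nil. Qed.

Lemma eval_cons g w : eval (g :: w) = e g * eval w.
Proof. exact: big_cons. Qed.

Lemma eval_cat u v : eval (u ++ v) = eval u * eval v.
Proof. exact: big_cat. Qed.

Lemma oeval_cat u o : oeval (omap (cat u) o) = eval u * oeval o.
Proof. by case: o => [w|] /=; rewrite ?eval_cat ?mulr0. Qed.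

Lemma oeval_cons g o : oeval (omap (cons g) o) = e g * oeval o.
Proof. by case: o => [w|] /=; rewrite ?eval_cons ?mulr0. Qed.

Hypothesis e_rel : forall l o, word_rel l o -> eval l = oeval o.

Lemma eval_rel l m v : word_rel l (Some m) -> eval (l ++ v) = eval (m ++ v).
Proof. by move=> /e_rel E; rewrite !eval_cat E. Qed.

Lemma eval_lact_s w : eval (lact_s w) = e gs * eval w.
Proof.
rewrite -eval_cons; elim: w => // g w IHw; case: g => // [k|] /=.
  by rewrite eval_cons IHw -eval_cons; apply/esym/(eval_rel w (W4 k)).
by rewrite eval_cons IHw -eval_cons; apply/esym/(eval_rel w W3).
Qed.

Lemma oeval_lact_Q q w : oeval (lact_Q q w) = e (gQ q) * eval w.
Proof.
rewrite /lact_Q; case: ifP => [/andP[/eqP-> /eqP]|_]; last exact: eval_cons.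
case: w => //= g w [->]; rewrite -eval_cons.
by rewrite -[_ :: _ :: w]/([:: gQ (st 4); gP (co 3)] ++ w) eval_cat (e_rel W11) mul0r.
Qed.

Lemma oeval_move x i j v : tape_gen x ->
  oeval (move x i j v) = eval (gt :: x :: gQ i :: gP j :: v).
Proof.
have E := (cat_cons, cat0s, oeval_cat, oeval_cons, oeval_lact_Q, eval_cons, eval_lact_s).
rewrite /move; case I: (instr i j) => [[[[|] q] p]|] // tx.
  case: x tx => // [k|] _.
    by rewrite (eval_rel v (W5 k I)) !E.
  by rewrite (eval_rel v (W6 I)) !E.
case: v => // g v; case: g => //.
- move=> k; case: x tx => // [l|] _.
    by rewrite (eval_rel v (W7 k l I)) !E -!mulrA eval_nil mul1r.
  by rewrite (eval_rel v (W8 k I)) !E -!mulrA eval_nil mul1r.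
- case: x tx => // [l|] _.
    by rewrite (eval_rel v (W9 l I)) !E -!mulrA eval_nil mul1r.
  by rewrite (eval_rel v (W10 I)) !E -!mulrA eval_nil mul1r.
Qed.

Lemma oeval_lact_t w : oeval (lact_t w) = eval (gt :: w).
Proof.
elim: w => [|x w IHw] //; rewrite [lact_t _]/=; case: ifP => // tx.
case: w IHw => [|g w] // IHw; case: g IHw => // [k|i] IHw.
  rewrite oeval_cons IHw -eval_cons.
  by case: x tx => // [l|] _; [rewrite (eval_rel w (W2 l k))|rewrite (eval_rel w (W1 k))].
by case: w IHw => [|g w] // IHw; case: g IHw => // j _; apply: oeval_move.
Qed.

Lemma oeval_lact g w : oeval (lact g w) = e g * eval w.
Proof.
case: g => [||k|q|k||] /=; rewrite ?eval_cons //.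
- by rewrite oeval_lact_t eval_cons.
- exact: eval_lact_s.
- exact: oeval_lact_Q.
Qed.

(** Each rewriting done by the action is an instance of a relation, so it keeps the value by
    [e_rel]. *)
Lemma oeval_nf w : oeval (nf w) = eval w.
Proof.
elim: w => //= g w IHw; rewrite eval_cons -IHw /= -/(nf w).
by case: (nf w) => [v|] /=; rewrite ?oeval_lact ?mulr0.
Qed.

End Evaluation.

(** * The linear normal form map on the free algebra *)

Section FreeAlgebra.
Variable K : fieldType.
Local Notation F := (free_alg K).

Definition mword (w : seq gen) : F := << FMonom w >>.
Definition omword (o : option (seq gen)) : F := oapp mword 0 o.

Lemma mword_cat u v : mword (u ++ v) = mword u * mword v.
Proof.
rewrite /mword malgM_def fgmulUU mulr1; congr << _ >>.
exact/esym/fmmulE.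
Qed.

Lemma mword1 g : mword [:: g] = freegen K g.
Proof. by rewrite /freegen fmuE. Qed.

Lemma mword_rcons w g : mword (rcons w g) = mword w * freegen K g.
Proof. by rewrite -cats1 mword_cat mword1. Qed.

(** Left-nested and without an initial factor [1], so that it unfolds to the form in which the
    relators are written. *)
Definition fprod (g : gen) (w : seq gen) : F :=
  foldl (fun x h => x * freegen K h) (freegen K g) w.

Lemma mwordE g w : mword (g :: w) = fprod g w.
Proof.
elim/last_ind: w => [|w h IHw]; first exact: mword1.
by rewrite -rcons_cons mword_rcons IHw /fprod foldl_rcons.
Qed.

Lemma word_rel_relator l o : word_rel l o -> relator (mword l - omword o).
Proof.
case=> [k|k l'||k|i j q p k|i j q p|i j q p k l'|i j q p k|i j q p l'|i j q p|];
  rewrite /omword /oapp !mwordE /fprod /foldl.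
- exact: Z1.
- exact: Z2.
- exact: Z3.
- exact: Z4.
- exact: Z5.
- exact: Z6.
- exact: Z7.
- exact: Z8.
- exact: Z9.
- exact: Z10.
- by rewrite subr0; exact: Z11.
Qed.

Lemma relator_word_rel r : relator r ->
  exists l o, word_rel l o /\ r = mword l - omword o.
Proof.
have E l o x : word_rel l o -> x = mword l - omword o ->
    exists l o, word_rel l o /\ x = mword l - omword o by exists l, o.
case=> [k|k l||k|i j q p k e|i j q p e|i j q p k l e|i j q p k e|i j q p l e|
    i j q p e|].
- by apply: (E _ _ _ (W1 k)); rewrite /omword /oapp !mwordE.
- by apply: (E _ _ _ (W2 k l)); rewrite /omword /oapp !mwordE.
- by apply: (E _ _ _ W3); rewrite /omword /oapp !mwordE.
- by apply: (E _ _ _ (W4 k)); rewrite /omword /oapp !mwordE.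
- by apply: (E _ _ _ (W5 k e)); rewrite /omword /oapp !mwordE.
- by apply: (E _ _ _ (W6 e)); rewrite /omword /oapp !mwordE.
- by apply: (E _ _ _ (W7 k l e)); rewrite /omword /oapp !mwordE.
- by apply: (E _ _ _ (W8 k e)); rewrite /omword /oapp !mwordE.
- by apply: (E _ _ _ (W9 l e)); rewrite /omword /oapp !mwordE.
- by apply: (E _ _ _ (W10 e)); rewrite /omword /oapp !mwordE.
- by apply: (E _ _ _ W11); rewrite /omword /oapp !mwordE subr0.
Qed.

Lemma mword_ind (P : F -> Prop) :
  P 0 -> (forall x y, P x -> P y -> P (x + y)) ->
  (forall c w, P (c *: mword w)) -> forall x, P x.
Proof. by move=> P0 PD PZ; apply: malg_ind => // c m; have := PZ c m; rewrite /mword fmK. Qed.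

(** This is the projection onto the span of the normal words; [nfl_ideal] and [Hpi_nfl] together
    show that its kernel is the ideal. *)
Definition nfl : F -> F := linext (fun m : {fmonom gen} => omword (nf m)).

Lemma nfl_word w : nfl (mword w) = omword (nf w).
Proof. exact: linextU. Qed.

Lemma nfl0 : nfl 0 = 0.
Proof. exact: linext0. Qed.

Lemma nflD x y : nfl (x + y) = nfl x + nfl y.
Proof. exact: linextD. Qed.

Lemma nflZ c x : nfl (c *: x) = c *: nfl x.
Proof. exact: linextZ. Qed.

Lemma nflB x y : nfl (x - y) = nfl x - nfl y.
Proof. exact: linextB. Qed.

Lemma nfl_ideal x : ideal_gen (@relator K) x -> nfl x = 0.
Proof.
apply: (ideal_gen_ker (f := nfl) nfl0 nflD nflZ
  (@free_scalerAr K) mword_ind) => r u v /relator_word_rel[l [o [lo ->]]].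
have {lo} := nf_rel u v lo; case: o => [m|] E; rewrite /omword /oapp; last first.
  by rewrite subr0 -!mword_cat nfl_word -catA E.
rewrite (mulrBr (mword u)) (mulrBl (mword v)) -!mword_cat -!catA.
by rewrite nflB !nfl_word E subrr.
Qed.

Lemma HpiM (x y : F) : Hpi (x * y) = Hpi x * Hpi y.
Proof. exact: rmorphM. Qed.

Lemma Hpi_mword w : Hpi (mword w) = eval (Hgen K) w.
Proof.
elim: w => [|g w IHw].
  rewrite /eval big_nil -(rmorph1 (@Hpi K)); congr Hpi.
  by rewrite /mword -fmoneE.
by rewrite -cat1s mword_cat mword1 HpiM IHw /eval big_cons.
Qed.

Lemma Hpi_omword o : Hpi (omword o) = oeval (Hgen K) o.
Proof. by case: o => [w|]; [exact: Hpi_mword|exact: rmorph0]. Qed.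

Lemma Hgen_rel l o : word_rel l o -> eval (Hgen K) l = oeval (Hgen K) o.
Proof.
move=> /word_rel_relator /ideal_base /Hpi_eq0 /eqP.
by rewrite raddfB /= Hpi_mword Hpi_omword subr_eq0 => /eqP.
Qed.

Lemma eval_nf_Hgen w : oeval (Hgen K) (nf w) = eval (Hgen K) w.
Proof. exact: oeval_nf Hgen_rel w. Qed.

Lemma Hpi_nfl x : Hpi (nfl x) = Hpi x.
Proof.
elim/mword_ind: x => [|x y IHx IHy|c w].
- by rewrite nfl0.
- by rewrite nflD !raddfD /=; congr (_ + _).
rewrite nflZ !Hpi_scalable nfl_word Hpi_omword Hpi_mword.
by rewrite eval_nf_Hgen.
Qed.

End FreeAlgebra.

(** * Normal words are nonzero in [H]; cancellation of configuration words *)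

Section NormalFormsInjectivity.
Variable K : fieldType.
Local Notation F := (free_alg K).

Lemma mcoeff_omword o (m : {fmonom gen}) :
  (omword K o)@_m = (o == Some (fmonom_val m))%:R.
Proof.
case: o => [w|]; last exact: mcoeff0.
by rewrite /omword /oapp /mword mcoeffU1 fmP.
Qed.

Lemma msupp_nfl (x : F) m : m \in msupp (nfl x) -> normal m.
Proof.
rewrite -mcoeff_neq0; apply: contra_neqT => nm.
elim/mword_ind: x => [|x y IHx IHy|c w].
- by rewrite nfl0 mcoeff0.
- by rewrite nflD mcoeffD IHx IHy addr0.
rewrite nflZ mcoeffZ nfl_word mcoeff_omword.
by case: eqP => [/nf_is_normal|_]; rewrite ?(negPf nm) ?mulr0.
Qed.

(** Distinct normal words go to distinct words and none to zero, so no terms cancel: the coefficient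
    of [m] in [y] reappears at the word [g m]. *)
Lemma linext_omword_eq0 (g : seq gen -> option (seq gen)) (y : F) :
  (forall m, m \in msupp y -> normal m) ->
  (forall u, normal u -> isSome (g u)) ->
  (forall u v, normal u -> normal v -> g u = g v -> u = v) ->
  linext (fun m : {fmonom gen} => omword K (g m)) y = 0 -> y = 0.
Proof.
move=> ny gS g_inj gy0; apply/malgP => m; rewrite mcoeff0.
apply/eqP/negPn/negP; rewrite mcoeff_neq0 => my.
have := gS _ (ny _ my); case gm: (g m) => [v|] // _.
have := congr1 (mcoeff (FMonom v)) gy0; rewrite mcoeff0 /linext raddf_sum /=.
rewrite (bigD1_seq m) ?fset_uniq //= big1_seq => [|m' /andP[m'm my']].
  rewrite addr0 mcoeffZ mcoeff_omword gm eqxx mulr1 => /eqP.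
  by rewrite mcoeff_eq0 my.
rewrite mcoeffZ mcoeff_omword; case: eqP => [gm'|]; last by rewrite mulr0.
case/eqP: m'm; apply/eqP; rewrite fmP; apply/eqP.
by apply: g_inj; rewrite ?ny // gm.
Qed.

Lemma nfl_mulr (y : F) w :
  nfl (y * mword K w) = linext (fun m : {fmonom gen} => omword K (nf (m ++ w))) y.
Proof.
elim/mword_ind: y => [|x y IHx IHy|c u].
- by rewrite mul0r nfl0 linext0.
- rewrite (mulrDl x y) nflD.
  exact: etrans (congr2 +%R IHx IHy) (esym (linextD _ x y)).
rewrite -scalerAl nflZ -mword_cat nfl_word.
apply/esym/(etrans (linextZ _ c _)); congr (c *: _); exact: linextU.
Qed.

Lemma nfl_mull (y : F) w :
  nfl (mword K w * y) = linext (fun m : {fmonom gen} => omword K (nf (w ++ m))) y.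
Proof.
elim/mword_ind: y => [|x y IHx IHy|c u].
- by rewrite mulr0 nfl0 linext0.
- rewrite (mulrDr _ x y) nflD.
  exact: etrans (congr2 +%R IHx IHy) (esym (linextD _ x y)).
rewrite -free_scalerAr nflZ -mword_cat nfl_word.
apply/esym/(etrans (linextZ _ c _)); congr (c *: _); exact: linextU.
Qed.

(** [nfl] fixes a normal word but kills the ideal. *)
Lemma eval_normal_neq0 w : normal w -> eval (Hgen K) w != 0.
Proof.
move=> nw; apply/eqP; rewrite -Hpi_mword => /Hpi_eq0 /nfl_ideal /eqP.
rewrite nfl_word (nf_normal nw) /omword /oapp monalgU_eq0.
by rewrite oner_eq0.
Qed.

(** On normal words, left multiplication by the configuration word is plain prepending, hence
    injective. *)
Lemma conf_lreg c (y : H K) : ~ halts c ->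
  eval (Hgen K) (conf_word c) * y = 0 -> y = 0.
Proof.
(* [y] is represented by [nfl x], whose support consists of normal words. *)
move=> nh; have [x ->] := Hpi_surj y; rewrite -Hpi_nfl -Hpi_mword -HpiM.
move=> /Hpi_eq0 /nfl_ideal; rewrite nfl_mull => E.
(* The run of length [0] shows that [c] itself is not stopped. *)
have [_ [<-] cN] := run_of_not_halts 0 nh.
have nfc u : normal u -> nf (conf_word c ++ u) = Some (conf_word c ++ u).
  by move=> nu; rewrite nf_cat (nf_normal nu) lact_seq_conf (negPf cN).
rewrite (linext_omword_eq0 (g := fun u => nf (conf_word c ++ u)) _ _ _ E);
  first exact: raddf0.
- by move=> m; apply: msupp_nfl.
- by move=> u /nfc ->.
by move=> u v /nfc -> /nfc -> [] /eqP; rewrite eqseq_cat // eqxx => /eqP.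
Qed.

(** Here the product is rewritten by the running machine, and injectivity on normal words comes from
    [nf_normal_conf_inj]. *)
Lemma conf_rreg c (y : H K) : ~ halts c ->
  y * eval (Hgen K) (conf_word c) = 0 -> y = 0.
Proof.
move=> nh; have [x ->] := Hpi_surj y; rewrite -Hpi_nfl -Hpi_mword -HpiM.
move=> /Hpi_eq0 /nfl_ideal; rewrite nfl_mulr => E.
rewrite (linext_omword_eq0 (g := fun u => nf (u ++ conf_word c)) _ _ _ E);
  first exact: raddf0.
- by move=> m; apply: msupp_nfl.
- by move=> u /(nf_normal_conf nh)[v [n [c' [_ _ ->]]]].
by move=> u v nu nv; apply: (nf_normal_conf_inj nh nu nv).
Qed.

End NormalFormsInjectivity.

Theorem theorem7p2 (K : fieldType) (i : 'I_7) (j : 'I_4) (U V : seq 'I_4) :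
  zero_divisor (Hgen K gL * (\prod_(u <- U) Hgen K (ga u)) *
                Hgen K (gQ i) * Hgen K (gP j) *
                (\prod_(v <- V) Hgen K (ga v)) * Hgen K gR)
  <-> halts (T i j U V).
Proof.
set c := T i j U V.
have ->: Hgen K gL * (\prod_(u <- U) Hgen K (ga u)) * Hgen K (gQ i) *
    Hgen K (gP j) * (\prod_(v <- V) Hgen K (ga v)) * Hgen K gR
    = eval (Hgen K) (conf_word c).
  rewrite /conf_word eval_cons eval_cat !eval_cons eval_cat eval_cons eval_nil.
  by rewrite mulr1 /eval !big_map !mulrA.
split=> [[[X XN XW]|[Y YN YW]]|[n [c' [E [si sj]]]]].
(* Without halting, multiplication by the word is injective on either side. *)
- by apply: contrapT => nh; case/eqP: XN; apply: conf_rreg XW.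
- by apply: contrapT => nh; case/eqP: YN; apply: conf_lreg YW.
(* The annihilator is [t^n], with [n] the number of steps to the stop pair; it is normal because no
   left-hand side contains [t] followed by [t]. *)
left; exists (eval (Hgen K) (nseq n gt)).
  apply: eval_normal_neq0; elim: n {E} => // n IHn.
  by rewrite /= IHn andbT; case: n {IHn} => [|n] /=; rewrite eqxx.
(* After [n] steps the configuration is stopped, so the normal form is [None], that is, zero. *)
rewrite -eval_cat -eval_nf_Hgen (nf_run E).
by rewrite /stopped si sj !eqxx.
Qed.
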